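(* Let $n$ be a positive even integer. Then the $2n$-crossed prism graph $\mathcal{CP}_n$ is PMH.
   Context: All graphs are finite, simple and connected. A graph $G$ admitting a perfect matching is said to be PMH (to have the Perfect-Matching-Hamiltonian property) if for every perfect matching $M$ of $G$ there exists another perfect matching $N$ of $G$, with $M\cap N=\emptyset$, such that the edges of $M\cup N$ induce a Hamiltonian cycle of $G$. For a positive integer $n$, the $2n$-crossed prism graph $\mathcal{CP}_n$ is the graph on the $8n$ vertices $\{u_i,v_i : i=1,\dots,4n\}$ whose edges are exactly: the edges of the cycle $(u_1u_2\dots u_{4n})$ of length $4n$; the edges $u_iv_i$ for $i=1,\dots,4n$; and the edges $\{v_{2i-1}v_{2i} : i=1,\dots,2n\}\cup\{v_{2i-1}v_{2i+2} : i=1,\dots,2n-1\}\cup\{v_{4n-1}v_2\}$, which form a cycle of length $4n$ on the vertices $v_i$. *)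

(* Defs.v *)
From mathcomp Require Import all_boot.
From mathcomp Require Import zify.

Set Implicit Arguments.
Unset Strict Implicit.
Unset Printing Implicit Defensive.

Record graph := Graph {
  vertex :> finType;
  adj : rel vertex;
  adj_sym : symmetric adj;
  adj_irr : irreflexive adj;
  adj_connected : forall x y, connect adj x y }.

Section PerfectMatchings.

Variable G : graph.

(* An edge is the two-element set of its ends. *)
Definition edges : {set {set G}} :=
  [set [set p.1; p.2] | p : G * G & adj p.1 p.2].

Definition perfect_matching (M : {set {set G}}) : Prop :=
  M \subset edges /\ forall x : G, #|[set f in M | x \in f]| = 1.

(* [F] is the edge set of a cycle of [G], listed cyclically without repetition
   as [c], that passes through every vertex. *)
Definition hamiltonian_cycle (F : {set {set G}}) : Prop :=
  exists c : seq G,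
    [/\ 2 < size c, ucycle (@adj G) c, (forall x : G, x \in c)
      & F = [set [set x; next c x] | x in c]].

Definition PMH : Prop :=
  (exists M, perfect_matching M) /\
  forall M, perfect_matching M ->
    exists N, [/\ perfect_matching N, M :&: N = set0
                & hamiltonian_cycle (M :|: N)].

End PerfectMatchings.

Section CrossedPrism.

Variable n : nat.

(* With [i : 'I_(4 * n)], [inl i] is the vertex u_(i+1) and [inr i] is v_(i+1):
   the subscripts 1, ..., 4n are the successors of the ordinals. *)
Definition cp_vertex : finType := ('I_(4 * n) + 'I_(4 * n))%type.

(* u_a u_b, oriented along the cycle (u_1 u_2 ... u_(4n)). *)
Definition u_arc (a b : nat) : bool :=
  (b == a + 1) || (a == 4 * n) && (b == 1).

(* v_a v_b, oriented from the odd subscript a = 2i-1 to the even one. *)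
Definition v_arc (a b : nat) : bool :=
  [|| odd a && (b == a + 1), odd a && (b == a + 3)
    | (a == 4 * n - 1) && (b == 2)].

Definition cp_adj (x y : cp_vertex) : bool :=
  match x, y with
  | inl i, inl j => u_arc i.+1 j.+1 || u_arc j.+1 i.+1
  | inr i, inr j => v_arc i.+1 j.+1 || v_arc j.+1 i.+1
  | inl i, inr j | inr i, inl j => i == j
  end.

Lemma cp_adj_sym : symmetric cp_adj.
Proof.
by move=> [i|i] [j|j]; [exact: orbC | exact: eq_sym | exact: eq_sym | exact: orbC].
Qed.

Lemma cp_adj_irr : irreflexive cp_adj.
Proof.
by move=> [i|i] /=; rewrite orbb /u_arc /v_arc; have := ltn_ord i; lia.
Qed.

Lemma cp_adj_connected x y : connect cp_adj x y.
Proof.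
have csym : connect_sym cp_adj by apply: sym_connect_sym cp_adj_sym.
have cuu k (i j : 'I_(4 * n)) :
    nat_of_ord j = i + k -> connect cp_adj (inl i) (inl j).
  elim: k j => [|k IHk] j ji.
    by rewrite (_ : i = j) ?connect0 //; apply: val_inj; rewrite /= ji addn0.
  have lt_ik : i + k < 4 * n by have := ltn_ord j; lia.
  apply: connect_trans (IHk (Ordinal lt_ik) erefl) (connect1 _).
  by rewrite /= /u_arc ji addnS addn1 eqxx.
have cu i j : connect cp_adj (inl i) (inl j).
  have [le_ij|/ltnW le_ji] := leqP i j; first by apply: (cuu (j - i)); lia.
  by rewrite csym; apply: (cuu (i - j)); lia.
have toU z : exists i, connect cp_adj z (inl i).
  by case: z => i; exists i; rewrite ?connect0 // connect1 //= eqxx.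
have [[i xi] [j yj]] := (toU x, toU y).
by apply: connect_trans xi (connect_trans (cu i j) _); rewrite csym.
Qed.

Definition crossed_prism : graph :=
  Graph cp_adj_sym cp_adj_irr cp_adj_connected.

End CrossedPrism.

(* Main.v *)
Require Import Defs.
From mathcomp Require Import all_boot.
From mathcomp Require Import zify.

Set Implicit Arguments.
Unset Strict Implicit.
Unset Printing Implicit Defensive.

(** If a Hamiltonian cycle contains the perfect matching M, then it has even
    length and alternates between M and its other edges, so those other edges
    form the wanted perfect matching N. It is therefore enough to put every
    perfect matching inside a Hamiltonian cycle (alternating_walk_extends).

    The crossed prism is a ring of 2n four-cycles, the blocks. With indices i
    taken modulo 2n, block i is spanned by the rungs, all four edges between
    its left ports u_(2i+1), v_(2i+2) and its right ports u_(2i+2), v_(2i+1).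
    Ports carry a label, false for u and true for v, and a link joins each
    right port of block i to the left port of block i+1 with the same label.
    Two families of Hamiltonian cycles use a sequence e of labels.
    - If e is 2n-periodic, the cycle once_around e goes once around the ring
      and visits all four ports of each block: it enters block i by the left
      port labelled e i and leaves it by the right port labelled e (i+1).
    - If e changes sign after 2n steps, the cycle twice_around e goes twice
      around the ring, crossing block i from the left port labelled e i to
      the right port labelled e (i+1), and visits on the second tour the
      ports missed by the first.

    Let M be a perfect matching. Inside a block, rungs cover as many left ports
    as right ports, so M uses the same number of links on both sides of the
    block, hence the same number k between any two consecutive blocks.
    - If k = 1 (extend_single_links), let e i be the label of the link of M
      that enters block i. Then M contains the rung joining the two ports of
      block i that those links miss, and once_around e contains all of M.
    - If k = 2 (extend_all_links), M consists of the links, and any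
      twice_around e contains it.
    - If k = 0 (extend_no_links), M pairs the ports of each block, preserving
      the labels or exchanging them. Let e i count modulo 2 the exchanging
      blocks before block i, so that e follows M through the blocks. If their
      total number is odd, e changes sign after 2n steps and twice_around e
      contains M. If it is even, e is periodic; adding the parity of i to e i
      keeps it so, the number of blocks being even, and once_around of the
      new sequence contains M, because its first and third edges in block i
      join ports whose labels agree exactly when e i and e (i+1) do. *)

(** * Perfect matchings and Hamiltonian walks *)

Lemma set2_eqr (T : finType) (x y z : T) : [set x; y] = [set x; z] -> y = z.
Proof.
move=> e; have : y \in [set x; z] by rewrite -e set22.
have : z \in [set x; y] by rewrite e set22.
by rewrite !inE => /orP[] /eqP-> // /orP[] /eqP.
Qed.

Lemma perfect_matching_unique (G : graph) (M : {set {set G}}) :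
  perfect_matching M ->
  forall x f g, f \in M -> g \in M -> x \in f -> x \in g -> f = g.
Proof.
case=> _ M1 x f g fM gM xf xg.
have /eqP/cards1P[h eh] := M1 x.
have : f \in [set h] by rewrite -eh inE fM.
have : g \in [set h] by rewrite -eh inE gM.
by rewrite !inE => /eqP-> /eqP.
Qed.

Lemma perfect_matching_adj (G : graph) (M : {set {set G}}) :
  perfect_matching M -> forall x y, [set x; y] \in M -> adj x y.
Proof.
case=> /subsetP Me _ x y /Me /imsetP[[a b]]; rewrite inE /= => ab e.
have [xab yab] : x \in [set a; b] /\ y \in [set a; b] by rewrite -e set21 set22.
have nab : a != b by apply: contraTneq ab => ->; rewrite adj_irr.
move: xab e; rewrite !inE => /orP[] /eqP->; last rewrite [RHS]setUC;
  by move/set2_eqr=> -> //; rewrite adj_sym.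
Qed.

Lemma perfect_matching_partner (G : graph) (M : {set {set G}}) :
  perfect_matching M -> forall x, exists y, [set x; y] \in M.
Proof.
case=> /subsetP Me M1 x.
have /eqP/cards1P[h eh] := M1 x.
have : h \in [set f in M | x \in f] by rewrite eh inE.
rewrite inE => /andP[hM]; have /imsetP[[a b] _ /= eab] := Me _ hM.
rewrite eab in hM *; rewrite !inE => /orP[] /eqP->; first by exists b.
by exists a; rewrite setUC.
Qed.

Definition exactly_one (a b c : bool) : bool := a + b + c == 1.

Lemma exactly_one_edge (G : graph) (M : {set {set G}}) (x y1 y2 y3 : G) :
  perfect_matching M ->
  (forall y, adj x y = [|| y == y1, y == y2 | y == y3]) ->
  y1 != y2 -> y1 != y3 -> y2 != y3 ->
  exactly_one ([set x; y1] \in M) ([set x; y2] \in M) ([set x; y3] \in M).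
Proof.
move=> pM xadj n12 n13 n23; have [y xyM] := perfect_matching_partner pM x.
have inM z : ([set x; z] \in M) = (z == y).
  apply/idP/eqP => [xzM|-> //]; apply: (@set2_eqr _ x).
  by apply: (perfect_matching_unique pM xzM xyM); exact: set21.
have := perfect_matching_adj pM xyM; rewrite xadj !inM /exactly_one.
case/or3P=> /eqP->; rewrite eqxx.
- by rewrite ![_ == y1]eq_sym (negbTE n12) (negbTE n13).
- by rewrite (negbTE n12) [_ == y2]eq_sym (negbTE n23).
- by rewrite (negbTE n13) (negbTE n23).
Qed.

(** Indexing a cyclic tour of the vertices by all of nat, periodically, avoids
    any special treatment of its closing edge. Repetitions within a period are
    excluded by counting: as many steps as vertices, and every vertex met. *)
Definition hamiltonian_walk (G : graph) (w : nat -> G) : Prop :=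
  [/\ forall k, w (k + #|G|) = w k, forall k, adj (w k) (w k.+1)
    & forall x, exists k, w k = x].

Lemma walk_mod (G : graph) (w : nat -> G) :
  hamiltonian_walk w -> forall k, w (k %% #|G|) = w k.
Proof.
case=> wp _ _ k; rewrite [in RHS](divn_eq k #|G|).
elim: (k %/ _) => [|q IHq] //; rewrite mulSn.
by rewrite (_ : _ + _ = q * #|G| + k %% #|G| + #|G|) ?wp //; lia.
Qed.

Lemma walk_uniq (G : graph) (w : nat -> G) :
  hamiltonian_walk w -> uniq (mkseq w #|G|).
Proof.
move=> hw; have wm := walk_mod hw; case: hw => _ _ ws.
have := @leq_size_uniq _ (enum G) (mkseq w #|G|); apply.
- exact: enum_uniq.
- move=> x _; have [k <-] := ws x; rewrite -wm map_f // mem_iota /= ltn_mod.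
  by apply/card_gt0P; exists x.
- by rewrite size_mkseq cardE.
Qed.

Lemma walk_inj (G : graph) (w : nat -> G) :
  hamiltonian_walk w -> forall j k, w j = w k -> j = k %[mod #|G|].
Proof.
move=> hw j k; rewrite -(walk_mod hw) -(walk_mod hw k) => e.
have Gp : 0 < #|G| by apply/card_gt0P; exists (w 0).
by apply: (mkseq_uniqP _ _ (walk_uniq hw)); rewrite ?inE ?ltn_mod.
Qed.

Lemma walk_congr (G : graph) (w : nat -> G) : hamiltonian_walk w ->
  forall j k, j = k %[mod #|G|] -> w j = w k.
Proof. by move=> hw j k e; rewrite -(walk_mod hw) e (walk_mod hw). Qed.

Lemma next_walk (G : graph) (w : nat -> G) : hamiltonian_walk w ->
  forall k, next (mkseq w #|G|) (w k) = w k.+1.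
Proof.
move=> hw k.
have Gp : 0 < #|G| by apply/card_gt0P; exists (w 0).
rewrite -(walk_mod hw) -[in RHS]addn1.
have : k + 1 = k %% #|G| + 1 %[mod #|G|] by rewrite modnDml.
move/(walk_congr hw)->; have lt := ltn_pmod k Gp.
move: (k %% _) lt => {}k lt.
have kin : w k \in mkseq w #|G| by rewrite map_f // mem_iota.
rewrite next_nth kin -{2}(nth_mkseq (w 0) w lt).
rewrite index_uniq ?size_mkseq ?walk_uniq // addn1.
have [lt1|ge1] := ltnP k.+1 #|G|.
  rewrite /mkseq -(prednK Gp) /= in lt1 *.
  by rewrite (nth_map 0) ?size_iota // nth_iota.
(* At the last position, next wraps around to the default value w 0. *)
have -> : k.+1 = #|G| by lia.
have [wp _ _] := hw; rewrite -[in RHS](add0n #|G|) wp.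
rewrite /mkseq -(prednK Gp) /= nth_default // size_map size_iota.
by rewrite -ltnS prednK.
Qed.

Definition walk_edge (G : graph) (w : nat -> G) k : {set G} := [set w k; w k.+1].

Lemma eq_walk_edge (G : graph) (w : nat -> G) : hamiltonian_walk w ->
  forall j k, w j = w k -> walk_edge w j = walk_edge w k.
Proof.
by move=> hw j k e; rewrite /walk_edge -(next_walk hw j) -(next_walk hw k) e.
Qed.

Lemma hamiltonian_walk_cycle (G : graph) (w : nat -> G) :
  2 < #|G| -> hamiltonian_walk w ->
  hamiltonian_cycle [set walk_edge w k | k : 'I_#|G|].
Proof.
move=> G2 hw; have wm := walk_mod hw; have [_ wa ws] := hw.
have Gp : 0 < #|G| by apply: leq_trans G2.
have all_c x : x \in mkseq w #|G|.
  by have [k <-] := ws x; rewrite -wm map_f // mem_iota /= ltn_mod.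
exists (mkseq w #|G|); split; rewrite ?size_mkseq //.
- rewrite /ucycle walk_uniq // andbT.
  apply: cycle_from_next; first exact: walk_uniq.
  by move=> x _; have [k <-] := ws x; rewrite next_walk.
- apply/setP=> f; apply/imsetP/imsetP=> [[k _ ->]|[x _ ->]].
    by exists (w k); rewrite ?next_walk.
  have [k <-] := ws x; have lt : k %% #|G| < #|G| by rewrite ltn_mod.
  by exists (Ordinal lt) => //; rewrite /walk_edge /= -!(next_walk hw) wm.
Qed.

Definition extends_to_hamiltonian_cycle (G : graph) (M : {set {set G}}) : Prop :=
  exists N, [/\ perfect_matching N, M :&: N = set0
              & hamiltonian_cycle (M :|: N)].

(** Each vertex lies on two consecutive edges of the walk, and exactly one of
    them has index of parity b, hence belongs to M; the other one is the edge
    at that vertex of the complementary perfect matching. *)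
Lemma alternating_walk_extends (G : graph) (M : {set {set G}}) (w : nat -> G) b :
  2 < #|G| -> perfect_matching M -> hamiltonian_walk w ->
  (forall k, odd k = b -> walk_edge w k \in M) ->
  extends_to_hamiltonian_cycle M.
Proof.
move=> G2 pM hw wM; set F := [set walk_edge w k | k : 'I_#|G|].
have [Me _] := pM; have [wp wa ws] := hw.
have Gp : 0 < #|G| by lia.
have inF k : walk_edge w k \in F.
  apply/imsetP; exists (Ordinal (ltn_pmod k Gp)) => //.
  by apply: eq_walk_edge; rewrite // (walk_mod hw).
have FP f : f \in F -> exists k, f = walk_edge w k.
  by case/imsetP=> k _ ->; exists k.
have at_w k j : w k.+1 \in walk_edge w j ->
    walk_edge w j = walk_edge w k \/ walk_edge w j = walk_edge w k.+1.
  rewrite !inE => /orP[] /eqP e; [right|left]; apply: eq_walk_edge => //.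
  have : j = k %[mod #|G|].
    by apply/eqP; rewrite -(eqn_modDr 1) !addn1; apply/eqP/(walk_inj hw).
  by move/(walk_congr hw).
(* Consecutive edges differ because w k and w (k+2) do. *)
have neq k : walk_edge w k != walk_edge w k.+1.
  apply/eqP; rewrite /walk_edge setUC => /set2_eqr/(walk_inj hw)/eqP.
  by rewrite -addn2 -[k in k == _ %[mod _]]addn0 eqn_modDl mod0n modn_small.
have two_edges x : exists f g, [/\ f \in M, f \in F, g \in F,
    [/\ x \in f, x \in g & f != g]
    & forall h, h \in F -> x \in h -> h = f \/ h = g].
  have [k <-] : exists k, w k.+1 = x.
    by have [k <-] := ws x; exists (k + #|G|.-1); rewrite -(wp k); congr w; lia.
  have [xk xk1] : w k.+1 \in walk_edge w k /\ w k.+1 \in walk_edge w k.+1.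
    by rewrite set21 set22.
  case: (eqVneq (odd k) b) => kb.
    exists (walk_edge w k), (walk_edge w k.+1); split; rewrite ?wM //.
    by move=> h /FP[j ->] /at_w.
  have {}kb : odd k.+1 = b by move: kb; rewrite /=; case: (odd k) (b) => [] [].
  exists (walk_edge w k.+1), (walk_edge w k); split; rewrite ?wM //.
    by split; rewrite // eq_sym.
  by move=> h /FP[j ->] /at_w[->|->]; [right|left].
have MF : M \subset F.
  apply/subsetP=> h hM.
  have [x xh] : exists x, x \in h.
    by move/(subsetP Me): hM => /imsetP[[x y] _ ->]; exists x; exact: set21.
  have [f [g [fM fF _ [xf _ _] _]]] := two_edges x.
  by rewrite (perfect_matching_unique pM hM fM xh xf).
exists (F :\: M); split.
- split.
    apply/subsetP=> f /setDP[/FP[k ->] _].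
    by apply/imsetP; exists (w k, w k.+1); rewrite ?inE /= ?wa.
  move=> x; have [f [g [fM _ gF [xf xg fg] fgP]]] := two_edges x.
  apply/eqP/cards1P; exists g; apply/setP=> h; rewrite !inE.
  apply/idP/eqP => [/andP[/andP[hM hF] xh]|->].
    by case: (fgP h hF xh) => // hf; rewrite hf fM in hM.
  rewrite gF xg !andbT; apply: contra_neqN fg => gM.
  exact: perfect_matching_unique pM _ _ _ fM gM xf xg.
- by apply/setP=> f; rewrite !inE; case: (f \in M).
- rewrite (_ : M :|: _ = F); first exact: hamiltonian_walk_cycle.
  apply/setP=> f; rewrite !inE; have := subsetP MF f.
  by case: (f \in M) => //= ->.
Qed.

(** * The crossed prism as a ring of four-cycles *)

Section Prism.

Variable n : nat.
Hypothesis n_gt0 : 0 < n.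

Local Notation CP := (crossed_prism n).

Lemma cp_index_gt0 : 0 < 4 * n. Proof. by rewrite muln_gt0. Qed.

Definition cp_index (l : nat) : 'I_(4 * n) := Ordinal (ltn_pmod l cp_index_gt0).

(** The block of index i is a four-cycle in which the left ports
    u_(2i+1), v_(2i+2) are opposite, and so are the right ports u_(2i+2),
    v_(2i+1). The label s tells the cycle of the u (false) from that of the v
    (true); crossing the v-subscripts makes every edge between consecutive
    blocks join ports with equal labels. *)
Definition lport (i : nat) (s : bool) : CP :=
  if s then inr (cp_index (2 * i + 1)) else inl (cp_index (2 * i)).

Definition rport (i : nat) (s : bool) : CP :=
  if s then inr (cp_index (2 * i)) else inl (cp_index (2 * i + 1)).

Lemma cp_index_period l : cp_index (l + 4 * n) = cp_index l.
Proof. by apply: val_inj; rewrite /= modnDr. Qed.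

Lemma double_period i : 2 * (i + 2 * n) = 2 * i + 4 * n.
Proof. lia. Qed.

Lemma lport_period i s : lport (i + 2 * n) s = lport i s.
Proof. by rewrite /lport double_period addnAC !cp_index_period. Qed.

Lemma rport_period i s : rport (i + 2 * n) s = rport i s.
Proof. by rewrite /rport double_period addnAC !cp_index_period. Qed.

Lemma card_crossed_prism : #|CP| = 8 * n.
Proof. rewrite /= card_sum !card_ord; lia. Qed.

Lemma lport_or_rport (x : CP) :
  exists i s, x = lport i s \/ x = rport i s.
Proof.
have split_index (i : 'I_(4 * n)) : i = cp_index (2 * i./2 + odd i).
  by apply: val_inj; rewrite /= mul2n addnC odd_double_half modn_small.
case: x => i; exists i./2.
  exists false; rewrite /lport /rport {1 3}(split_index i).
  by case: (odd i); [right|left]; rewrite ?addn0.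
exists true; rewrite /lport /rport {1 3}(split_index i).
by case: (odd i); [left|right]; rewrite ?addn0.
Qed.

Lemma modS k : k.+1 %% (4 * n) =
  if k %% (4 * n) == (4 * n).-1 then 0 else (k %% (4 * n)).+1.
Proof.
have n4 := cp_index_gt0; have lt := ltn_pmod k n4.
rewrite -addn1 -modnDml addn1; case: eqP => [->|ne].
  by rewrite prednK // modnn.
by rewrite modn_small //; lia.
Qed.

Lemma odd_mod4n k : odd (k %% (4 * n)) = odd k.
Proof. by rewrite odd_mod // oddM. Qed.

(** Rewriting the arcs as equalities of cyclic indices removes the special
    cases of the edges that close the two cycles. *)
Lemma u_arc_from l (b : 'I_(4 * n)) :
  u_arc n (cp_index l).+1 b.+1 = (b == cp_index l.+1).
Proof.
have lt := ltn_pmod l cp_index_gt0; have := ltn_ord b.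
rewrite /u_arc -val_eqE /= modS; move: (l %% _) lt => a lt.
by case: (_ =P (4 * n).-1); lia.
Qed.

Lemma u_arc_to l (b : 'I_(4 * n)) :
  u_arc n b.+1 (cp_index l.+1).+1 = (b == cp_index l).
Proof.
have lt := ltn_pmod l cp_index_gt0; have := ltn_ord b.
rewrite /u_arc -val_eqE /= modS; move: (l %% _) lt => a lt.
by case: (_ =P (4 * n).-1); lia.
Qed.

(** The reduction modulo 4n wraps around only after an odd number. *)
Lemma mod_even l : ~~ odd l ->
  l.+1 %% (4 * n) = (l %% (4 * n)).+1 /\ (l %% (4 * n)).+1 < 4 * n.
Proof.
have lt := ltn_pmod l cp_index_gt0; rewrite -odd_mod4n modS.
by move: (l %% _) lt => a lt; case: (_ =P (4 * n).-1); lia.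
Qed.

Lemma v_arc_from l (b : 'I_(4 * n)) : ~~ odd l ->
  v_arc n (cp_index l).+1 b.+1 = (b == cp_index l.+1) || (b == cp_index l.+3).
Proof.
move=> ev; have ev2 : ~~ odd l.+2 by rewrite /= negbK.
have [[e1 lt1] [e3 lt3]] := (mod_even ev, mod_even ev2).
move: ev lt1 lt3 (ltn_ord b); rewrite -odd_mod4n /v_arc -!val_eqE /= e3 modS e1.
move: (l %% _) => a ev lt1 lt3 ltb; rewrite ev /= addn1 addn3 !eqSS.
case: (_ =P (4 * n).-1) lt3 => [wrap|nowrap] lt3.
  have -> : (nat_of_ord b == a.+3) = false by lia.
  by have -> : a.+1 == 4 * n - 1 by lia.
by rewrite subn1 (negbTE (introN eqP nowrap)) orbF.
Qed.

Lemma v_arc_to l (b : 'I_(4 * n)) : ~~ odd l ->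
  v_arc n b.+1 (cp_index l.+3).+1 = (b == cp_index l) || (b == cp_index l.+2).
Proof.
move=> ev; have ev2 : ~~ odd l.+2 by rewrite /= negbK.
have [[e1 lt1] [e3 lt3]] := (mod_even ev, mod_even ev2).
move: ev lt1 lt3 (ltn_ord b); rewrite -odd_mod4n /v_arc -!val_eqE /= e3 modS e1.
move: (l %% _) => a ev lt1 lt3 ltb; rewrite addn1 addn3 !eqSS.
case: (_ =P (4 * n).-1) lt3 => [wrap|nowrap] lt3.
  have -> : ~~ odd b && (1 == b.+1) = (nat_of_ord b == 0).
    by rewrite eqSS; case: (nat_of_ord b) => [|k] //=; rewrite andbF.
  by rewrite andbF andbT orbC subn1 -wrap eqSS.
have even_eq k : ~~ odd k -> ~~ odd b && (k == b) = (nat_of_ord b == k).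
  by move=> evk; rewrite eq_sym; case: eqP => [->|]; rewrite ?evk ?andbF.
rewrite !eqSS even_eq ?(even_eq a) // ?negbK //.
by rewrite (_ : (a.+2 == 0) = false) // andbF orbF orbC.
Qed.

Lemma v_arc_parity a b : v_arc n a b -> odd a && ~~ odd b.
Proof. rewrite /v_arc; have := n_gt0; lia. Qed.

Lemma lport_adj i s y : @adj CP (lport i.+1 s) y =
  [|| y == rport i s, y == rport i.+1 false | y == rport i.+1 true].
Proof.
have ev : ~~ odd (2 * i) by rewrite oddM.
have d2 : 2 * i.+1 = (2 * i).+2 by lia.
rewrite /lport /rport d2 !addn1; case: s y => [] [b|b] //=.
- by rewrite /eq_op /= eq_sym orbF.
- rewrite v_arc_to //; case: (boolP (v_arc _ _ _)) => [/v_arc_parity|_].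
    by rewrite /= negbK -/(cp_index _) odd_mod4n /= ev.
  by rewrite /eq_op /=.
- by rewrite u_arc_from u_arc_to /eq_op /= orbF orbC.
- by rewrite /eq_op /= eq_sym.
Qed.

Lemma rport_adj i s y : @adj CP (rport i s) y =
  [|| y == lport i.+1 s, y == lport i false | y == lport i true].
Proof.
have ev : ~~ odd (2 * i) by rewrite oddM.
have d2 : 2 * i.+1 = (2 * i).+2 by lia.
rewrite /lport /rport d2 !addn1; case: s y => [] [b|b] //=.
- by rewrite /eq_op /= eq_sym orbF.
- rewrite v_arc_from //; case: (boolP (v_arc _ b.+1 _)) => [/v_arc_parity|_].
    by rewrite /= negbK odd_mod4n /= (negbTE ev) andbF.
  by rewrite /eq_op /= orbF orbC.
- by rewrite u_arc_from u_arc_to /eq_op /= orbF.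
- by rewrite /eq_op /= eq_sym.
Qed.

Lemma rport_lport_adj i s : @adj CP (rport i s) (lport i.+1 s).
Proof. by rewrite rport_adj eqxx. Qed.

Lemma lport_rport_adj i s t : @adj CP (lport i s) (rport i t).
Proof. by rewrite adj_sym rport_adj; case: s; rewrite eqxx ?orbT. Qed.

Lemma cp_index_neq l : (cp_index l.+2 == cp_index l) = false.
Proof.
apply/negbTE/eqP=> /(congr1 val)/eqP.
by rewrite /= -addn2 -[X in _ == X %[mod _]]addn0 eqn_modDl mod0n modn_small; lia.
Qed.

Lemma rport_neq i s t : (rport i s == rport i.+1 t) = false.
Proof.
have d2 : 2 * i.+1 = (2 * i).+2 by lia.
rewrite eq_sym /rport d2 !addn1.
by case: s t => [] [] //; rewrite /eq_op /= cp_index_neq.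
Qed.

Lemma lport_neq i s t : (lport i.+1 s == lport i t) = false.
Proof.
have d2 : 2 * i.+1 = (2 * i).+2 by lia.
rewrite /lport d2 !addn1.
by case: s t => [] [] //; rewrite /eq_op /= cp_index_neq.
Qed.

(** * Two families of Hamiltonian walks *)

(** In block i this walk visits the left port e i, the right port ~~ e i.+1,
    the left port ~~ e i and the right port e i.+1, from which it follows the
    link to block i+1. *)
Definition once_around (e : nat -> bool) (k : nat) : CP :=
  let i := k %/ 4 in
  if odd k then rport i (e i.+1 (+) (k %% 4 == 1))
  else lport i (e i (+) (k %% 4 == 2)).

Lemma once_aroundE e i :
  [/\ once_around e (i * 4) = lport i (e i),
      once_around e (i * 4).+1 = rport i (~~ e i.+1),
      once_around e (i * 4).+2 = lport i (~~ e i),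
      once_around e (i * 4).+3 = rport i (e i.+1)
    & once_around e (i * 4).+4 = lport i.+1 (e i.+1)].
Proof.
have at_offset r : r < 4 -> once_around e (i * 4 + r) =
    if odd r then rport i (e i.+1 (+) (r == 1)) else lport i (e i (+) (r == 2)).
  move=> r4; rewrite /once_around divnMDl // modnMDl oddD oddM andbF.
  by rewrite divn_small // modn_small // addn0.
split.
- by rewrite -[i * 4]addn0 at_offset //= addbF.
- by rewrite -addn1 at_offset //= addbT.
- by rewrite -addn2 at_offset //= addbT.
- by rewrite -addn3 at_offset //= addbF.
rewrite /once_around -[_.+4]/(4 + i * 4) addnC -mulSnr mulnK // modnMl.
by rewrite oddM andbF addbF.
Qed.

Lemma mod4_cases k : exists i,
  [\/ k = i * 4, k = (i * 4).+1, k = (i * 4).+2 | k = (i * 4).+3].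
Proof.
move: (k %/ 4) (k %% 4) (ltn_pmod k (isT : 0 < 4)) (divn_eq k 4) => i r.
move=> lt ->; exists i; case: r lt => [|[|[|[|]]]] // _.
- by rewrite addn0; exact: Or41.
- by rewrite addn1; exact: Or42.
- by rewrite addn2; exact: Or43.
- by rewrite addn3; exact: Or44.
Qed.

Lemma once_around_hamiltonian e :
  (forall i, e (i + 2 * n) = e i) -> hamiltonian_walk (once_around e).
Proof.
move=> ep; split=> [k|k|x].
- rewrite card_crossed_prism (_ : k + _ = 2 * n * 4 + k); last by lia.
  rewrite /once_around divnMDl // modnMDl oddD oddM andbF /= addnC -addSn.
  by rewrite rport_period lport_period !ep.
- have [i ik] := mod4_cases k; have [w0 w1 w2 w3 w4] := once_aroundE e i.
  case: ik => ->; rewrite ?(w0, w1, w2, w3, w4).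
  + exact: lport_rport_adj.
  + by rewrite adj_sym; exact: lport_rport_adj.
  + exact: lport_rport_adj.
  + exact: rport_lport_adj.
- have [i [s [->|->]]] := lport_or_rport x.
    have [w0 _ w2 _ _] := once_aroundE e i.
    have [<-|ne] := eqVneq (e i) s; first by exists (i * 4).
    by exists (i * 4).+2; rewrite w2; case: (e i) s ne => [] [].
  have [_ w1 _ w3 _] := once_aroundE e i.
  have [<-|ne] := eqVneq (e i.+1) s; first by exists (i * 4).+3.
  by exists (i * 4).+1; rewrite w1; case: (e i.+1) s ne => [] [].
Qed.

Definition twice_around (e : nat -> bool) (k : nat) : CP :=
  let i := k./2 in if odd k then rport i (e i.+1) else lport i (e i).

Lemma twice_aroundE e i :
  [/\ twice_around e i.*2 = lport i (e i),
      twice_around e i.*2.+1 = rport i (e i.+1)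
    & twice_around e i.*2.+2 = lport i.+1 (e i.+1)].
Proof.
by rewrite /twice_around /= odd_double doubleK uphalf_double.
Qed.

Lemma mod2_cases k : exists i, k = i.*2 \/ k = i.*2.+1.
Proof.
exists k./2; rewrite -{1 3}(odd_double_half k).
by case: (odd k); [right|left].
Qed.

(** The sign change of e makes the second tour use the ports that the first
    one leaves out, and its two sign changes close the walk after two tours. *)
Lemma twice_around_hamiltonian e :
  (forall i, e (i + 2 * n) = ~~ e i) -> hamiltonian_walk (twice_around e).
Proof.
move=> ea; split=> [k|k|x].
- rewrite card_crossed_prism (_ : k + _ = k + (2 * n + 2 * n).*2); last by lia.
  rewrite /twice_around halfD odd_double andbF oddD odd_double addbF doubleK add0n.
  rewrite -(addSn k./2) (addnA k./2) (addnA k./2.+1).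
  by rewrite !rport_period !lport_period !ea !negbK.
- have [i ik] := mod2_cases k; have [w0 w1 w2] := twice_aroundE e i.
  case: ik => ->; rewrite ?(w0, w1, w2).
    exact: lport_rport_adj.
  exact: rport_lport_adj.
- have [i [s [->|->]]] := lport_or_rport x.
    have [w0 _ _] := twice_aroundE e i.
    have [<-|ne] := eqVneq (e i) s; first by exists i.*2.
    exists (i + 2 * n).*2; have [-> _ _] := twice_aroundE e (i + 2 * n).
    by rewrite lport_period ea; case: (e i) s ne => [] [].
  have [_ w1 _] := twice_aroundE e i.
  have [<-|ne] := eqVneq (e i.+1) s; first by exists i.*2.+1.
  exists (i + 2 * n).*2.+1; have [_ -> _] := twice_aroundE e (i + 2 * n).
  by rewrite rport_period -addSn ea; case: (e i.+1) s ne => [] [].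
Qed.

(** * Extending a perfect matching *)

Section Matching.

Variable M : {set {set CP}}.
Hypothesis pM : perfect_matching M.

Definition rung i s t := [set lport i s; rport i t] \in M.

(** The link enters block i, from block i - 1; that index is written
    i + (2n - 1) because subtraction would truncate at i = 0. *)
Definition link i s := [set rport (i + (2 * n).-1) s; lport i s] \in M.

Lemma linkS i s : link i.+1 s = ([set rport i s; lport i.+1 s] \in M).
Proof.
by rewrite /link (_ : _ + _ = i + 2 * n) ?rport_period //; lia.
Qed.

Lemma link_period i s : link (i + 2 * n) s = link i s.
Proof. by rewrite /link addnAC rport_period lport_period. Qed.

Lemma rung_period i s t : rung (i + 2 * n) s t = rung i s t.
Proof. by rewrite /rung rport_period lport_period. Qed.

Lemma lport_exactly_one i s :
  exactly_one (link i s) (rung i s false) (rung i s true).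
Proof.
rewrite -link_period -2!(rung_period i) -[2 * n]prednK ?muln_gt0 // addnS.
rewrite linkS setUC; apply: (exactly_one_edge pM); rewrite ?rport_neq //.
exact: lport_adj.
Qed.

Lemma rport_exactly_one i t :
  exactly_one (link i.+1 t) (rung i false t) (rung i true t).
Proof.
have flip s : rung i s t = ([set rport i t; lport i s] \in M).
  by rewrite /rung setUC.
rewrite linkS !flip; apply: (exactly_one_edge pM); rewrite ?lport_neq //.
exact: rport_adj.
Qed.

(** What one block passes on, from the fact that each of its four ports is
    covered exactly once: the parity of the number of links used on its left,
    and that number itself when it is 0 or 2. If it is 0, the rungs used form
    one of the two perfect matchings of the block, the second coordinate of a
    rung being its first one shifted by rung i false true. If it is 1, then
    link i true is the label of the link used on the left, and the rung used
    joins the ports missed by the links used on both sides. *)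
Lemma block_laws i :
  [/\ link i.+1 false (+) link i.+1 true = link i false (+) link i true,
      link i false = link i true ->
        link i.+1 false = link i false /\
        (~~ link i false -> forall s, rung i s (s (+) rung i false true)),
      link i false != link i true -> link i (link i true)
    & link i false != link i true ->
        rung i (~~ link i true) (~~ link i.+1 true)].
Proof.
move: (lport_exactly_one i false) (lport_exactly_one i true).
move: (rport_exactly_one i false) (rport_exactly_one i true).
case Ll: (link i true); case Lr: (link i.+1 true); move: Ll Lr => /= Ll Lr;
case Ll': (link i false); case Lr': (link i.+1 false);
case r00: (rung i false false); case r01: (rung i false true);
case r10: (rung i true false); case r11: (rung i true true) => //= _ _ _ _;
split=> //; split=> // _ [] //=.
Qed.

Lemma card_crossed_prism_gt2 : 2 < #|CP|.
Proof. rewrite card_crossed_prism; lia. Qed.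

(** In once_around e with e i the label of the link of M entering block i, the
    edges of odd index are those links and the middle edge of each block, which
    joins the ports missed by the links: they all belong to M. *)
Lemma extend_single_links :
  link 0 false != link 0 true -> extends_to_hamiltonian_cycle M.
Proof.
move=> single0.
have single i : link i false != link i true.
  elim: i => // i; have [par _ _ _] := block_laws i.
  by rewrite !negb_eqb par.
pose e i := link i true.
have ham : hamiltonian_walk (once_around e).
  by apply: once_around_hamiltonian => i; exact: link_period.
apply: (alternating_walk_extends (b := true) card_crossed_prism_gt2 pM ham) => k.
have [i ik] := mod4_cases k; have [_ w1 w2 w3 w4] := once_aroundE e i.
rewrite /walk_edge; case: ik => -> /=; rewrite ?oddM ?andbF // => _.
  rewrite w1 w2 setUC; have [_ _ _] := block_laws i; exact.
rewrite w3 w4 -linkS; have [_ _ + _] := block_laws i.+1; exact.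
Qed.

(** Every second edge of a walk twice_around e is a link, whatever e is, so any
    sequence that changes sign after 2n steps will do. *)
Lemma extend_all_links : (forall i s, link i s) -> extends_to_hamiltonian_cycle M.
Proof.
move=> all_links; pose e i := odd (i %/ (2 * n)).
have ham : hamiltonian_walk (twice_around e).
  apply: twice_around_hamiltonian => i.
  by rewrite /e divnDr // divnn muln_gt0 n_gt0 addn1.
apply: (alternating_walk_extends (b := true) card_crossed_prism_gt2 pM ham) => k.
have [i ik] := mod2_cases k; have [_ w1 w2] := twice_aroundE e i.
rewrite /walk_edge; case: ik => -> /=; rewrite odd_double // => _.
by rewrite w1 w2 -linkS.
Qed.

(** The strand that follows M through the blocks and the links between them
    comes back, after one tour, to the other label or to its own. In the first
    case it closes up after two tours into a Hamiltonian cycle. In the second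
    one, the rungs of M are the first and third edges of once_around f in each
    block as soon as ~~ f i.+1 is the partner of f i; changing the sign of the
    strand in every other block achieves this, and the number of blocks being
    even, f is still periodic. *)
Lemma extend_no_links :
  (forall i s, rung i s (s (+) rung i false true)) -> extends_to_hamiltonian_cycle M.
Proof.
move=> rungs; pose p i := rung i false true.
pose e i := \big[addb/false]_(j < i) p j.
have eS i : e i.+1 = e i (+) p i by rewrite /e big_ord_recr.
have shift i : e (i + 2 * n) = e i (+) e (2 * n).
  elim: i => [|i IHi]; first by rewrite add0n /e big_ord0.
  by rewrite addSn !eS IHi /p rung_period addbAC.
case twist: (e (2 * n)) in shift.
  have ham : hamiltonian_walk (twice_around e).
    by apply: twice_around_hamiltonian => i; rewrite shift addbT.
  apply: (alternating_walk_extends (b := false) card_crossed_prism_gt2 pM ham).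
  move=> k; have [i ik] := mod2_cases k; have [w0 w1 _] := twice_aroundE e i.
  rewrite /walk_edge; case: ik => -> /=; rewrite odd_double // => _.
  rewrite w0 w1 eS; exact: rungs.
pose f i := e i (+) odd i.
have ham : hamiltonian_walk (once_around f).
  by apply: once_around_hamiltonian => i; rewrite /f shift addbF oddD oddM addbF.
have fS i : ~~ f i.+1 = f i (+) p i by rewrite /f eS /= addbN negbK addbAC.
apply: (alternating_walk_extends (b := false) card_crossed_prism_gt2 pM ham).
move=> k; have [i ik] := mod4_cases k; have [w0 w1 w2 w3 _] := once_aroundE f i.
rewrite /walk_edge; case: ik => -> /=; rewrite ?oddM ?andbF // => _.
  rewrite w0 w1 fS; exact: rungs.
rewrite w2 w3 -[f i.+1]negbK fS -addNb; exact: rungs.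
Qed.

Lemma perfect_matching_extension : extends_to_hamiltonian_cycle M.
Proof.
have [eq0|] := eqVneq (link 0 false) (link 0 true); last first.
  exact: extend_single_links.
have eq_links i : link i false = link i true /\ link i false = link 0 false.
  elim: i => // i [eqi ei]; have [par /(_ eqi)[e1 _] _ _] := block_laws i.
  split; last by rewrite e1.
  by apply/eqP; rewrite -[_ == _]negbK negb_eqb par eqi addbb.
case some_link: (link 0 false).
  apply: extend_all_links => i s; have [eqi ei] := eq_links i.
  by case: s; rewrite -?eqi ei.
apply: extend_no_links => i; have [eqi ei] := eq_links i.
by have [_ /(_ eqi)[_ r] _ _] := block_laws i; apply: r; rewrite ei some_link.
Qed.

End Matching.

Definition spoke (i : 'I_(4 * n)) : {set CP} := [set inl i; inr i].

Lemma spokes_perfect_matching : perfect_matching [set spoke i | i : 'I_(4 * n)].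
Proof.
split.
  apply/subsetP=> f /imsetP[i _ ->]; apply/imsetP.
  by exists (inl i, inr i); rewrite ?inE /=.
move=> x; apply/eqP/cards1P.
pose i := match x with inl i => i | inr i => i end.
exists (spoke i); apply/setP=> f; rewrite !inE.
apply/andP/eqP => [[/imsetP[j _ ->]]|->].
  by rewrite {}/i; case: x => i; rewrite !inE => /orP[] /eqP // [->].
split; first exact: imset_f.
by rewrite {}/i; case: x => i; rewrite !inE eqxx ?orbT.
Qed.

End Prism.

Theorem theorem3p8 (n : nat) (n_gt0 : 0 < n) (n_even : ~~ odd n) :
  PMH (crossed_prism n).
Proof.
split; first by eexists; exact: spokes_perfect_matching.
by move=> M pM; exact: (perfect_matching_extension n_gt0 pM).
Qed.
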